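(* Let $k>1$ be an integer and let $d=k^{2}+4$. Then the fundamental solution to the equation $x^{2}-dy^{2}=1$ is $$x_{1}+y_{1}\sqrt{d}=\begin{cases}\dfrac{k^{2}+2}{2}+\dfrac{k}{2}\sqrt{d} & \text{if } k \text{ is even},\\[2mm] \left(\dfrac{k^{3}+3k}{2}+\dfrac{k^{2}+1}{2}\sqrt{d}\right)^{2} & \text{if } k \text{ is odd}.\end{cases}$$
   Context: For a positive integer $d$ that is not a perfect square and a nonzero integer $N$, a pair $(a,b)$ of integers with $a^{2}-db^{2}=N$ is identified with $a+b\sqrt{d}$ and called a solution of $x^{2}-dy^{2}=N$; it is positive if $a>0$ and $b>0$. The fundamental solution of $x^{2}-dy^{2}=N$ is the positive solution $x_{1}+y_{1}\sqrt{d}$ such that $x_{1}+y_{1}\sqrt{d}<x_{2}+y_{2}\sqrt{d}$ for every other positive solution $x_{2}+y_{2}\sqrt{d}$ of the same equation. *)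

(* Defs.v *)
(* Stdlib world: integers are [Z], reals are the classical [R]. *)
From Stdlib Require Import Reals ZArith.
Open Scope Z_scope.

(* The real number a + b * sqrt d with which the pair (a, b) is identified. *)
Definition quad_val (d a b : Z) : R := (IZR a + IZR b * sqrt (IZR d))%R.

Definition is_solution (d N a b : Z) : Prop := a ^ 2 - d * b ^ 2 = N.

Definition is_positive_solution (d N a b : Z) : Prop :=
  is_solution d N a b /\ 0 < a /\ 0 < b.

(* Meant for d > 0 not a perfect square and N <> 0.  There is at most one such
   pair (x1, y1), since it is strictly below every other positive solution. *)
Definition is_fundamental_solution (d N x1 y1 : Z) : Prop :=
  is_positive_solution d N x1 y1 /\
  forall x2 y2 : Z,
    is_positive_solution d N x2 y2 ->
    (x2, y2) <> (x1, y1) ->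
    (quad_val d x1 y1 < quad_val d x2 y2)%R.

(* Main.v *)
Require Import Defs.
From Stdlib Require Import Reals ZArith.
From Stdlib Require Import Lia.
Open Scope Z_scope.

(** Let [theta = (k + sqrt d) / 2], a root of [theta ^ 2 = k * theta + 1] of
    norm [-1].  Writing [x + y * sqrt d = t + Y * theta] with [Y = 2 * y] and
    [t = x - k * y] turns the Pell equation into
    [t ^ 2 + k * t * Y - Y ^ 2 = 1], with [Y] even and, for a positive
    solution, [t > 0].

    The elements [t + Y * theta] of norm 1 with [t] and [Y] positive are the
    powers of [theta ^ 2 = 1 + k * theta].  What is needed of this is one step of descent,
    [norm_one_descent]: every such element is [theta ^ 2], or [theta ^ 2] times
    another such element.  Since multiplication by [theta ^ 2] increases both
    coordinates, descending bounds [Y] from below.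

    If [k] is even, [theta ^ 2] itself has [Y = k] even and is the smallest
    solution.  If [k] is odd, [theta ^ 2] and [theta ^ 4] have the odd
    coordinates [Y = k] and [Y = k ^ 3 + 2 * k], so the smallest solution is
    [theta ^ 6], the square of
    [theta ^ 3 = (k ^ 3 + 3 * k) / 2 + (k ^ 2 + 1) / 2 * sqrt d]. *)

(** On the positive branch of the hyperbola [x] increases with [y], so
    comparing the second coordinates is enough. *)
Lemma fundamental_of_minimal_y (d N x1 y1 : Z) :
  0 < d ->
  is_positive_solution d N x1 y1 ->
  (forall x y : Z, is_positive_solution d N x y -> y1 <= y) ->
  is_fundamental_solution d N x1 y1.
Proof.
  intros hd h1 hmin; split; [exact h1|].
  intros x2 y2 h2 hne.
  pose proof (hmin x2 y2 h2) as hy.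
  destruct h1 as (e1 & px1 & py1), h2 as (e2 & px2 & py2).
  unfold is_solution in e1, e2.
  assert (hy' : y1 < y2).
  { destruct (Z.eq_dec y1 y2) as [<-|]; [exfalso|lia].
    apply hne; f_equal; nia. }
  assert (hx' : x1 < x2).
  { assert (y1 ^ 2 < y2 ^ 2) by nia; nia. }
  unfold quad_val.
  apply Rplus_lt_compat; [now apply IZR_lt|].
  apply Rmult_lt_compat_r; [|now apply IZR_lt].
  apply sqrt_lt_R0; now apply (IZR_lt 0).
Qed.

(** Division by [theta ^ 2] sends [(t, Y)] to [(t - k * Y', Y')] with
    [Y' = Y - k * t].  The equation reads [Y * Y' = t ^ 2 - 1], which gives
    [Y' >= 0], and also [t * (t - k * Y') = Y' ^ 2 + 1], so the new first
    coordinate stays positive. *)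
Lemma norm_one_descent (k t Y : Z) :
  0 < t -> 0 < Y -> t ^ 2 + k * t * Y - Y ^ 2 = 1 ->
  (t = 1 /\ Y = k) \/
  exists t' Y' : Z,
    0 < t' /\ 0 < Y' /\ t' ^ 2 + k * t' * Y' - Y' ^ 2 = 1 /\
    t = t' + k * Y' /\ Y = Y' + k * t.
Proof.
  intros ht hY e.
  assert (e1 : Y * (Y - k * t) = t ^ 2 - 1) by lia.
  assert (e2 : t * (t - k * (Y - k * t)) = (Y - k * t) ^ 2 + 1) by lia.
  destruct (Z.eq_dec (Y - k * t) 0) as [h0|h0].
  - left. rewrite h0 in e1. assert (t = 1) by nia. subst t; lia.
  - right; exists (t - k * (Y - k * t)), (Y - k * t).
    repeat split; [nia|nia| |ring|ring].
    lia.
Qed.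

Lemma norm_one_ge (k t Y : Z) :
  0 < k -> 0 < t -> 0 < Y -> t ^ 2 + k * t * Y - Y ^ 2 = 1 -> k <= Y.
Proof.
  intros hk ht hY e.
  destruct (norm_one_descent k t Y ht hY e) as [[_ ->]|(t' & Y' & H)]; nia.
Qed.

(** For odd [k], evenness of [Y] rules out [theta ^ 2] and [theta ^ 4]; two
    descents then leave an element with [Y >= k].  Multiplying back by
    [theta ^ 4], the bound becomes the coordinate
    [k * (k ^ 2 + 1) * (k ^ 2 + 3)] of [theta ^ 6]. *)
Lemma norm_one_even_ge (k t Y : Z) :
  0 < k -> Z.Odd k -> Z.Even Y ->
  0 < t -> 0 < Y -> t ^ 2 + k * t * Y - Y ^ 2 = 1 ->
  k * (k ^ 2 + 1) * (k ^ 2 + 3) <= Y.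
Proof.
  intros hk [m hm] [n hn] ht hY e.
  destruct (norm_one_descent k t Y ht hY e)
    as [[_ h]|(t1 & Y1 & ht1 & hY1 & e1 & et & eY)]; [lia|].
  destruct (norm_one_descent k t1 Y1 ht1 hY1 e1)
    as [[h1 h2]|(t2 & Y2 & ht2 & hY2 & e2 & et1 & eY1)].
  - exfalso. subst t1 Y1 t Y k. lia.
  - pose proof (norm_one_ge k t2 Y2 hk ht2 hY2 e2) as h2.
    clear e e1 e2.
    assert (hmono : forall u v, u <= v -> k * u <= k * v)
      by (intros; apply Z.mul_le_mono_nonneg_l; lia).
    assert (b1 : 1 + k * k <= t1) by (specialize (hmono _ _ h2); lia).
    pose proof (hmono _ _ b1) as c1.
    assert (d1 : k + k * (1 + k * k) <= Y1) by lia.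
    pose proof (hmono _ _ d1) as b0.
    assert (d0 : 1 + k * k + k * (k + k * (1 + k * k)) <= t) by lia.
    pose proof (hmono _ _ d0).
    lia.
Qed.

Lemma norm_one_of_solution (k x y : Z) :
  0 < k -> is_positive_solution (k ^ 2 + 4) 1 x y ->
  0 < x - k * y /\
  (x - k * y) ^ 2 + k * (x - k * y) * (2 * y) - (2 * y) ^ 2 = 1.
Proof.
  intros hk (e & hx & hy); unfold is_solution in e; split; [|lia].
  assert ((k * y) ^ 2 < x ^ 2) by nia.
  nia.
Qed.

Theorem corollary2 (k d : Z) (hk : 1 < k) (hd : d = k ^ 2 + 4) :
  exists x1 y1 : Z,
    is_fundamental_solution d 1 x1 y1 /\
    quad_val d x1 y1 =
      (if Z.even k
       then (IZR k ^ 2 + 2) / 2 + IZR k / 2 * sqrt (IZR d)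
       else ((IZR k ^ 3 + 3 * IZR k) / 2
             + (IZR k ^ 2 + 1) / 2 * sqrt (IZR d)) ^ 2)%R.
Proof.
  assert (hd0 : 0 < d) by nia.
  destruct (Z.even k) eqn:hpar.
  - apply Z.even_spec in hpar; destruct hpar as [m hm].
    exists (2 * m ^ 2 + 1), m; split.
    + apply fundamental_of_minimal_y; [exact hd0| |].
      * split; [unfold is_solution; subst; ring|nia].
      * intros x y h; subst d.
        destruct (norm_one_of_solution k x y ltac:(lia) h) as [ht e].
        destruct h as (_ & _ & hy).
        pose proof (norm_one_ge k _ (2 * y) ltac:(lia) ht ltac:(lia) e); lia.
    + unfold quad_val.
      assert (hR : IZR k = (2 * IZR m)%R) by (rewrite hm, mult_IZR; reflexivity).
      rewrite hR, Z.pow_2_r, plus_IZR, !mult_IZR; field.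
  - assert (hodd : Z.Odd k).
    { apply Z.odd_spec; rewrite <- Z.negb_even, hpar; reflexivity. }
    pose proof hodd as [m hm].
    (* [theta ^ 3 = a + b * sqrt d], where [a] and [b] are integers since [k]
       is odd. *)
    set (b := 2 * m ^ 2 + 2 * m + 1).
    set (a := k * (b + 1)).
    assert (hb : 2 * b = k ^ 2 + 1) by (unfold b; subst k; ring).
    assert (ha : 2 * a = k ^ 3 + 3 * k) by (unfold a; lia).
    assert (hb0 : 0 < b) by nia.
    assert (ha0 : 0 < a) by (unfold a; nia).
    clearbody a b.
    assert (hnorm : a ^ 2 - d * b ^ 2 = -1).
    { assert (4 * (a ^ 2 - d * b ^ 2) = (2 * a) ^ 2 - d * (2 * b) ^ 2) by ring.
      rewrite ha, hb, hd in H; lia. }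
    exists (a ^ 2 + d * b ^ 2), (2 * a * b); split.
    + apply fundamental_of_minimal_y; [exact hd0| |].
      * split; [|clear - ha0 hb0 hd0; split; nia].
        unfold is_solution.
        replace ((a ^ 2 + d * b ^ 2) ^ 2 - d * (2 * a * b) ^ 2)
          with ((a ^ 2 - d * b ^ 2) ^ 2) by ring.
        rewrite hnorm; reflexivity.
      * intros x y h; subst d.
        destruct (norm_one_of_solution k x y ltac:(lia) h) as [ht e].
        destruct h as (_ & _ & hy).
        pose proof (norm_one_even_ge k _ (2 * y) ltac:(lia) hodd
                      ltac:(now exists y) ht ltac:(lia) e) as hle.
        assert (2 * (2 * a * b) = k * (k ^ 2 + 1) * (k ^ 2 + 3)).
        { replace (2 * (2 * a * b)) with ((2 * a) * (2 * b)) by ring.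
          rewrite ha, hb; ring. }
        lia.
    + assert (hbR : (2 * IZR b = IZR k ^ 2 + 1)%R).
      { rewrite <- mult_IZR, hb, Z.pow_2_r, plus_IZR, mult_IZR; ring. }
      assert (haR : (2 * IZR a = IZR k ^ 3 + 3 * IZR k)%R).
      { rewrite <- mult_IZR, ha.
        replace (k ^ 3) with (k * k * k) by ring.
        rewrite plus_IZR, !mult_IZR; ring. }
      rewrite <- hbR, <- haR.
      assert (hs : (sqrt (IZR d) * sqrt (IZR d) = IZR d)%R).
      { apply sqrt_sqrt; apply (IZR_le 0); lia. }
      unfold quad_val.
      rewrite !Z.pow_2_r, plus_IZR, !mult_IZR.
      rewrite <- hs at 1; field.
Qed.
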